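(* Let $a\ge 1$ and $\delta\ge 0$. There is a constant $M=M(a,\delta)\ge 1$, depending only on $a$ and $\delta$, with the following property. Let $(X,d)$ be a locally compact, incomplete, rectifiably connected metric space that is $a$-John with center $x_0\in X$, and suppose that $(X,k)$ is Gromov $\delta$-hyperbolic, where $k$ is the quasihyperbolic metric of $X$. Then every quasihyperbolic geodesic in $X$ starting from $x_0$ is an $M$-cone arc; that is, for every $x\in X$ and every quasihyperbolic geodesic $\alpha$ between $x$ and $x_0$, one has $\ell(\alpha[x,z])\le M\,d(z)$ for all $z\in\alpha$.
   Context: Let $(X,d)$ be a locally compact, incomplete, rectifiably connected metric space. Here rectifiably connected means that every two points are joined by a curve of finite $d$-length. Let $\bar X$ be the metric completion and $\partial X=\bar X\setminus X\neq\emptyset$ the metric boundary. For $x\in X$ write $d(x)=\operatorname{dist}(x,\partial X)$. $\ell(\gamma)$ denotes the $d$-length of a curve $\gamma$, and for an arc $\gamma$ and $u,v\in\gamma$, $\gamma[u,v]$ denotes the subarc of $\gamma$ with endpoints $u,v$. Quasihyperbolic metric: $k(x,y)=\inf_\gamma\int_\gamma \frac{|dz|}{d(z)}$, the infimum over all rectifiable curves $\gamma$ in $X$ with endpoints $x,y$, where $|dz|$ is the arc-length element with respect to $d$. It is part of the standing setting that $(X,k)$ is a complete, proper and geodesic metric space. A quasihyperbolic geodesic between $x$ and $y$ is a geodesic arc of $(X,k)$ with endpoints $x,y$, i.e. the image of an isometric embedding of $[0,k(x,y)]$ into $(X,k)$ joining $x$ to $y$. Cone arc and John space: for $a\ge1$,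 an arc $\gamma$ in $X$ joining $x$ to $x_0$ is an $a$-cone arc if $\ell(\gamma[x,z])\le a\,d(z)$ for all $z\in\gamma$. $X$ is $a$-John with center $x_0$ if for every $x\in X$ there is an $a$-cone arc in $X$ joining $x$ to $x_0$. Gromov hyperbolicity: a geodesic metric space is (Gromov) $\delta$-hyperbolic if for all triples of geodesics $[x,y],[y,z],[z,x]$, every point of $[x,y]$ is within distance $\delta$ of $[y,z]\cup[z,x]$. *)

(* Defs.v *)
From HB Require Import structures.
From mathcomp Require Import all_boot all_order all_algebra.
From mathcomp Require Import all_classical all_reals all_analysis.
Set Implicit Arguments.
Unset Strict Implicit.
Unset Printing Implicit Defensive.
Import Order.TTheory GRing.Theory Num.Theory.
Import numFieldNormedType.Exports.
Local Open Scope classical_set_scope.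
Local Open Scope ring_scope.

(* The library's completeType carries a base point, so completeness is restated
   here as a property of an arbitrary uniform space. *)
Definition complete_space (T : uniformType) : Prop :=
  forall F : set_system T, ProperFilter F -> cauchy F -> exists l : T, F --> l.

Definition proper_space (R : realType) (T : metricType R) : Prop :=
  forall (x : T) (r : R), compact [set y : T | mdist x y <= r].

(* A total function g : R -> T stands for the curve g restricted to [0, L];
   L = 0 gives the one-point curve. *)
Definition is_curve (R : realType) (T : metricType R) (x y : T) (L : R)
    (g : R -> T) : Prop :=
  [/\ 0 <= L, {within `[0, L], continuous g}, g 0 = x & g L = y].

(* An arc is given by an injective parametrization g on [0, L]; the subarc with
   endpoints g s and g t, s <= t, is then the restriction of g to [s, t].
   A single point is an arc from the point to itself. *)
Definition is_arc (R : realType) (T : metricType R) (x y : T) (L : R)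
    (g : R -> T) : Prop :=
  is_curve x y L g /\ {in `[0, L] &, injective g}.

(* The length of g restricted to [a, b]; a partition is the list of its points
   other than a, as in the library's total_variation. *)
Definition curve_length (R : realType) (T : metricType R) (g : R -> T)
    (a b : R) : \bar R :=
  ereal_sup [set (\sum_(0 <= n < size s)
      mdist (g (nth b (a :: s) n)) (g (nth b (a :: s) n.+1)))%:E
    | s in itv_partition a b].

Definition rectifiable_curve (R : realType) (T : metricType R) (x y : T)
    (L : R) (g : R -> T) : Prop :=
  is_curve x y L g /\ (curve_length g 0 L < +oo)%E.

Definition rectifiably_connected (R : realType) (T : metricType R) : Prop :=
  forall x y : T, exists (L : R) (g : R -> T), rectifiable_curve x y L g.

(* The arc-length parametrization, on [0, length g], of a rectifiable curve g:
   its value at s is g t for any t such that g restricted to [0, t] has length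
   s.  Such a t exists, and g t does not depend on its choice. *)
Definition arclength_param (R : realType) (T : metricType R) (g : R -> T)
    (L s : R) : T :=
  g (xget 0 [set t : R | 0 <= t <= L /\ curve_length g 0 t = s%:E]).

Definition path_integral (R : realType) (T : metricType R) (f : T -> R)
    (g : R -> T) (L : R) : \bar R :=
  (\int[lebesgue_measure]_(s in `[0%R, fine (curve_length g 0 L)])
     (f (arclength_param g L s))%:E)%E.

Definition is_completion (R : realType) (X Xbar : metricType R)
    (iota : X -> Xbar) : Prop :=
  [/\ complete_space Xbar,
      (forall x y : X, mdist (iota x) (iota y) = mdist x y) &
      dense (range iota)].

Definition metric_boundary (R : realType) (X Xbar : metricType R)
    (iota : X -> Xbar) : set Xbar := ~` range iota.

Definition boundary_dist (R : realType) (X Xbar : metricType R)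
    (iota : X -> Xbar) (x : X) : R :=
  inf [set mdist (iota x) b | b in metric_boundary iota].

(* For X locally compact and rectifiably connected the infimum is over a
   nonempty set of nonnegative real numbers, so fine loses nothing. *)
Definition qh_dist (R : realType) (X Xbar : metricType R) (iota : X -> Xbar)
    (x y : X) : R :=
  fine (ereal_inf [set I : \bar R | exists (L : R) (g : R -> X),
    rectifiable_curve x y L g /\
    I = path_integral (fun z : X => (boundary_dist iota z)^-1) g L]).

Definition is_cone_arc (R : realType) (X Xbar : metricType R)
    (iota : X -> Xbar) (a : R) (x y : X) (L : R) (g : R -> X) : Prop :=
  is_arc x y L g /\
  forall t : R, 0 <= t <= L ->
    (curve_length g 0 t <= (a * boundary_dist iota (g t))%:E)%E.

Definition is_John (R : realType) (X Xbar : metricType R) (iota : X -> Xbar)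
    (a : R) (x0 : X) : Prop :=
  forall x : X, exists (L : R) (g : R -> X), is_cone_arc iota a x x0 L g.

Record is_metric (R : realType) (T : Type) (k : T -> T -> R) : Prop :=
  IsMetric {
    is_metric_xx : forall x, k x x = 0 ;
    is_metric_eq : forall x y, k x y = 0 -> x = y ;
    is_metric_sym : forall x y, k x y = k y x ;
    is_metric_triangle : forall y x z, k x z <= k x y + k y z }.

(* The metric space (T, k); T may itself carry another metric. *)
Definition metric_space_of (R : realType) (T : Type) (k : T -> T -> R)
    (hk : is_metric k) : Type := T.

Section MetricSpaceOf.
Variables (R : realType) (T : Type) (k : T -> T -> R) (hk : is_metric k).

HB.instance Definition _ := gen_eqMixin (metric_space_of hk).
HB.instance Definition _ := gen_choiceMixin (metric_space_of hk).
HB.instance Definition _ := @isMetric.Build R (metric_space_of hk) k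
  (is_metric_xx hk) (is_metric_eq hk) (is_metric_sym hk)
  (is_metric_triangle hk).

End MetricSpaceOf.

(* The geodesic is the image of [0, mdist x y] under g. *)
Definition is_geodesic (R : realType) (K : metricType R) (x y : K)
    (g : R -> K) : Prop :=
  [/\ g 0 = x, g (mdist x y) = y &
      forall s t : R, 0 <= s <= mdist x y -> 0 <= t <= mdist x y ->
        mdist (g s) (g t) = `|s - t|].

Definition geodesic_space (R : realType) (K : metricType R) : Prop :=
  forall x y : K, exists g : R -> K, is_geodesic x y g.

Definition geodesic_image (R : realType) (K : metricType R) (x y : K)
    (g : R -> K) : set K := g @` `[0, mdist x y].

Definition gromov_hyperbolic (R : realType) (K : metricType R) (delta : R) :
    Prop :=
  forall (x y z : K) (gxy gyz gzx : R -> K),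
    is_geodesic x y gxy -> is_geodesic y z gyz -> is_geodesic z x gzx ->
    forall u : K, geodesic_image x y gxy u ->
    exists2 v : K,
      (geodesic_image y z gyz `|` geodesic_image z x gzx) v &
      mdist u v <= delta.

(* Main.v *)
Require Import Defs.
From HB Require Import structures.
From mathcomp Require Import all_boot all_order all_algebra.
From mathcomp Require Import all_classical all_reals all_analysis.
From mathcomp Require Import measurable_realfun.
From mathcomp Require Import ring lra.
Set Implicit Arguments.
Unset Strict Implicit.
Unset Printing Implicit Defensive.
Import Order.TTheory GRing.Theory Num.Theory.
Import numFieldNormedType.Exports.
Local Open Scope classical_set_scope.
Local Open Scope ring_scope.

(* Let rho be the distance to the boundary and let c be an a-cone arc from x to
   x0, parametrized by arc length s.  Then rho(c(s)) is comparable to rho(x) + s,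
   so in the parameter u = ln((rho(x) + s) / rho(x)) the arc c is Lipschitz for
   the quasihyperbolic metric k, while ln rho increases along it at unit rate up
   to a bounded error.  Since ln rho is 1-Lipschitz for k, c is a quasigeodesic
   of (X, k).  By the Morse lemma the geodesic alpha from x to x0, and each of
   its initial pieces, stays k-close to the corresponding piece of c.  Hence
   rho(alpha(s)) <= A exp(-(t - s) / C) rho(alpha(t)) for s <= t, and integrating
   this bound in s gives l(alpha[0, t]) <= M rho(alpha(t)). *)

(** * Geodesics and quasigeodesics in slim spaces *)

(* In a geodesic space, [between x u y] says that [u] lies on some geodesic from
   [x] to [y]; unlike geodesics themselves the relation is not oriented. *)
Definition between (R : realType) (K : metricType R) (x u y : K) : Prop :=
  mdist x u + mdist u y = mdist x y.

(** Thin triangles phrased pointwise: the sides through [u] and [v] stay implicit, so triangles can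
    be cut and reassembled without carrying parametrizations. *)
Definition slim (R : realType) (K : metricType R) (delta : R) : Prop :=
  forall x y z u : K, between x u y ->
  exists2 v, between y v z \/ between z v x & mdist u v <= delta.

Definition divisible (R : realType) (K : metricType R) : Prop :=
  forall (x y : K) (r : R), 0 <= r <= mdist x y ->
  exists2 u, between x u y & mdist x u = r.

Section Geodesics.
Variables (R : realType) (K : metricType R).
Implicit Types (x y u : K) (g : R -> K).

Lemma between_sym x u y : between x u y -> between y u x.
Proof.
by rewrite /between addrC [mdist u y]metric_sym [mdist x u]metric_sym
  [mdist x y]metric_sym.
Qed.

Lemma geodesic_mdist x y g s t : is_geodesic x y g ->
  0 <= s -> s <= t -> t <= mdist x y -> mdist (g s) (g t) = t - s.
Proof.
move=> [_ _ +] s0 st ty; move=> ->; first by rewrite distrC ger0_norm// subr_ge0.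
- by rewrite s0 (le_trans st).
- by rewrite ty (le_trans s0).
Qed.

Lemma geodesic_between x y g t : is_geodesic x y g -> 0 <= t <= mdist x y ->
  between x (g t) y /\ mdist x (g t) = t.
Proof.
move=> gg /andP[t0 ty]; have [g0 g1 _] := gg.
have xt : mdist x (g t) = t by rewrite -{1}g0 (geodesic_mdist gg)// subr0.
split=> //; rewrite /between xt -{1}g1 (geodesic_mdist gg)//.
by rewrite addrC subrK.
Qed.

(** Equality in the triangle inequality at [u] leaves no room for a shortcut, so geodesics from [x]
    to [u] and from [u] to [y] concatenate to a geodesic. *)
Lemma between_geodesic x y u : geodesic_space K -> between x u y ->
  exists2 g, is_geodesic x y g & g (mdist x u) = u.
Proof.
move=> geo xuy; have [g1 gg1] := geo x u; have [g2 gg2] := geo u y.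
have [g10 g11 _] := gg1; have [g20 g21 _] := gg2.
pose m := mdist x u.
pose g (t : R) := if t <= m then g1 t else g2 (t - m).
have m0 : 0 <= m := mdist_ge0 _ _.
have mD : m <= mdist x y by rewrite -xuy lerDl mdist_ge0.
have gm : g m = u by rewrite /g lexx.
have g0 : g 0 = x by rewrite /g m0.
have gD : g (mdist x y) = y.
  rewrite /g; case: ifPn => [Dm|_]; last by rewrite -xuy addrC addKr.
  have e : mdist x y = m by apply/le_anti; rewrite Dm mD.
  have uy : mdist u y = 0 by move: xuy; rewrite /between -/m e; lra.
  by rewrite e g11; exact: mdist_positivity.
have key s t : 0 <= s -> s <= t -> t <= mdist x y -> mdist (g s) (g t) = t - s.
  move=> s0 st tD; rewrite /g; case: ifPn => sm; case: ifPn => tm.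
  - by rewrite (geodesic_mdist gg1).
  (* Parameters on both sides of [m]: the upper bound passes through [u], the lower bound comes from
     the full distance between [x] and [y]. *)
  - have tm' : m < t by rewrite ltNge.
    have t2 : 0 <= t - m <= mdist u y by rewrite subr_ge0 (ltW tm') lerBlDl xuy.
    have [b1 d1] : between x (g1 s) u /\ mdist x (g1 s) = s.
      by apply: (geodesic_between gg1); rewrite s0.
    have [b2 d2] := geodesic_between gg2 t2.
    have T1 := metric_triangle (g1 s) u (g2 (t - m)).
    have T2 := metric_triangle x (g1 s) y.
    have T3 := metric_triangle (g1 s) (g2 (t - m)) y.
    have mE : m = mdist x u by [].
    move: xuy b1 b2; rewrite /between => xuy b1 b2.
    by apply/le_anti/andP; split; lra.
  - by have := le_trans st tm; rewrite (negbTE sm).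
  - have sm' : m < s by rewrite ltNge.
    rewrite (geodesic_mdist gg2) ?lerBlDl ?subrK ?xuy//; first lra.
      by rewrite subr_ge0 ltW.
    by rewrite addrC subrK.
exists g; last exact: gm.
split=> // s t /andP[s0 sD] /andP[t0 tD].
case: (leP s t) => [st|/ltW st].
  by rewrite key// distrC ger0_norm// subr_ge0.
by rewrite metric_sym key// ger0_norm// subr_ge0.
Qed.

Lemma geodesic_space_divisible : geodesic_space K -> divisible K.
Proof.
move=> geo x y r rD; have [g gg] := geo x y.
by have [? ?] := geodesic_between gg rD; exists (g r).
Qed.

Lemma gromov_slim delta :
  geodesic_space K -> gromov_hyperbolic K delta -> slim K delta.
Proof.
move=> geo hyp x y z u xuy.
have [g gg gu] := between_geodesic geo xuy.
have [g1 gg1] := geo y z; have [g2 gg2] := geo z x.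
have [|v v12 uv] := hyp x y z g g1 g2 gg gg1 gg2 u.
  by exists (mdist x u) => //=; rewrite in_itv/= mdist_ge0 -xuy lerDl mdist_ge0.
exists v => //; case: v12 => -[t /=]; rewrite in_itv/= => tI <-.
  by left; have [] := geodesic_between gg1 tI.
by right; have [] := geodesic_between gg2 tI.
Qed.

End Geodesics.

(** * Stability of quasigeodesics (Morse lemma) *)

Section QuasiGeodesics.
Variables (R : realType) (K : metricType R).
Implicit Types (x y w : K).

(* Bisecting the path, each halving costs one application of slimness. *)
Lemma path_near_log delta (C : R) (f : R -> K) N (s t : R) w :
  slim K delta ->
  (forall u v, s <= u -> u <= v -> v <= t -> mdist (f u) (f v) <= C * (v - u)) ->
  s <= t -> C * (t - s) <= 2 ^+ N -> between (f s) w (f t) ->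
  exists2 u, s <= u <= t & mdist w (f u) <= delta * N%:R + 1.
Proof.
move=> sl; elim: N s t w => [|N IH] s t w fL st CN b.
  (* Base case: the endpoints are at distance at most [2 ^+ 0 = 1], which accounts for the summand
     [1] in the bound. *)
  exists s; first by rewrite lexx st.
  have := fL _ _ (lexx s) st (lexx t); move: CN b; rewrite /between expr0 => CN b fst.
  by have := mdist_ge0 w (f t); rewrite [mdist w (f s)]metric_sym mulr0 add0r; lra.
pose m := (s + t) / 2.
have sm : s <= m by rewrite /m; lra.
have mt : m <= t by rewrite /m; lra.
have [v vb wv] := sl _ _ (f m) _ b.
have [u ust vu] : exists2 u, s <= u <= t & mdist v (f u) <= delta * N%:R + 1.
  case: vb => /between_sym vb.
  - have [|||u /andP[mu ut] vu] := IH m t v _ _ _ vb => //.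
    + by move=> u1 u2 mu uu ut; apply: fL => //; exact: le_trans mu.
    + by move: CN; rewrite exprS /m; lra.
    + by exists u => //; rewrite ut (le_trans sm).
  - have [|||u /andP[mu ut] vu] := IH s m v _ _ _ vb => //.
    + by move=> u1 u2 mu uu ut; apply: fL => //; exact: le_trans mt.
    + by move: CN; rewrite exprS /m; lra.
    + by exists u => //; rewrite mu (le_trans ut).
exists u => //; rewrite -natr1 mulrDr mulr1.
have := metric_triangle w v (f u); lra.
Qed.

(** The form fits its source, a Lipschitz curve along which a 1-Lipschitz function grows at unit
    rate up to [C']; hence an additive error and coefficient 1 in the lower bound only. *)
Definition quasi_geodesic (C C' U : R) (f : R -> K) : Prop :=
  forall u v, 0 <= u -> u <= v -> v <= U ->
  mdist (f u) (f v) <= C * (v - u) /\ v - u <= mdist (f u) (f v) + C'.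

Lemma quasi_geodesic_le (C C' U V : R) (f : R -> K) :
  V <= U -> quasi_geodesic C C' U f -> quasi_geodesic C C' V f.
Proof. by move=> VU qf u v u0 uv vV; apply: qf => //; exact: le_trans VU. Qed.

Definition fellow (U : R) (f : R -> K) (D : R) : Prop :=
  forall w, between (f 0) w (f U) ->
  exists2 u, 0 <= u <= U & mdist w (f u) <= D.

(** Going from [w] towards [x], stop at [y] after distance [2 * D + 2 * delta + 1], or at [x] if
    that comes first. In the former case the side from [y] to [f u] has length at most [D], so it
    stays farther than [2 * delta] from [w]; in the latter that side is the single point [x], which
    lies on the curve. *)
Lemma fellow_half (delta D U : R) (f : R -> K) x w : divisible K -> 0 <= delta -> 0 <= D ->
  (forall y, between x y w -> exists2 u, 0 <= u <= U & mdist y (f u) <= D) ->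
  (exists2 u, 0 <= u <= U & f u = x) ->
  exists y u, [/\ between x y w, mdist y w <= 2 * D + 2 * delta + 1,
    0 <= u <= U & mdist y (f u) <= D /\
    forall v, between y v (f u) -> mdist w v <= 2 * delta ->
      exists2 s, 0 <= s <= U & mdist w (f s) <= 2 * delta].
Proof.
move=> dv d0 D0 near [u0 u0U fu0].
case: (leP (mdist x w) (2 * D + 2 * delta + 1)) => xw.
  exists x, u0; split=> //; first by rewrite /between mdistxx add0r.
  split; first by rewrite fu0 mdistxx.
  move=> v; rewrite /between fu0 mdistxx => xv wv.
  have e : x = v.
    apply: mdist_positivity.
    have := mdist_ge0 x v; have := mdist_ge0 v x; lra.
  by exists u0; rewrite // fu0 e.
have [|y yb yw] := dv w x (2 * D + 2 * delta + 1).
  by rewrite [mdist w x]metric_sym (ltW xw) andbT; lra.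
move/between_sym: yb => yb.
have [u uU yu] := near y yb.
exists y, u; split=> //; first by rewrite metric_sym yw.
split=> // v; rewrite /between => vb wv.
have := metric_triangle w v y; have := mdist_ge0 v (f u).
rewrite [mdist v y]metric_sym; lra.
Qed.

(** The quadrilateral [y1], [y2], [f u2], [f u1], cut into two triangles, has [w] within [2 * delta]
    of one of its other three sides. By [fellow_half] the sides from [yi] to [f ui] are excluded or
    already give the claim. The ends of the remaining side are at distance linear in [D], so
    [path_near_log] applies with a loss logarithmic in [D]. *)
Lemma fellow_step (delta C C' U : R) (f : R -> K) (D : R) N : slim K delta -> divisible K ->
  0 <= delta -> 0 <= C -> 0 <= U -> quasi_geodesic C C' U f -> 0 <= D ->
  C * (6 * D + 4 * delta + 2 + C') <= 2 ^+ N ->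
  fellow U f D -> fellow U f (2 * delta + (delta * N%:R + 1)).
Proof.
move=> sl dv d0 C0 U0 qf D0 DN fD w wb.
have N0 : 0 <= delta * N%:R by rewrite mulr_ge0.
have sub1 y : between (f 0) y w -> between (f 0) y (f U).
  move: wb; rewrite /between => wb yb.
  have := metric_triangle (f 0) y (f U); have := metric_triangle y w (f U).
  move=> *; apply/le_anti/andP; split; lra.
have sub2 y : between (f U) y w -> between (f 0) y (f U).
  move=> /between_sym; move: wb; rewrite /between => wb yb.
  have := metric_triangle (f 0) y (f U); have := metric_triangle (f 0) w y.
  move=> *; apply/le_anti/andP; split; lra.
have [||y1 [u1 [b1 y1w /andP[u10 u1U] [y1u1 near1]]]] :=
    @fellow_half delta D U f (f 0) w dv d0 D0.
- by move=> y /sub1/fD.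
- by exists 0; rewrite // lexx.
have [||y2 [u2 [b2 y2w /andP[u20 u2U] [y2u2 near2]]]] :=
    @fellow_half delta D U f (f U) w dv d0 D0.
- by move=> y /sub2/fD.
- by exists U; rewrite // lexx U0.
have y1wy2 : between y1 w y2.
  move: wb b1 b2; rewrite /between => wb b1 b2.
  have := metric_triangle y1 w y2; have := metric_triangle (f 0) y1 (f U).
  have := metric_triangle y1 y2 (f U).
  move: b2; rewrite [mdist (f U) y2]metric_sym [mdist (f U) w]metric_sym.
  rewrite [mdist y2 w]metric_sym.
  move=> *; apply/le_anti/andP; split; lra.
have weaken (s : R) : 0 <= s <= U -> mdist w (f s) <= 2 * delta ->
  exists2 u, 0 <= u <= U & mdist w (f u) <= 2 * delta + (delta * N%:R + 1).
  move=> sU ws; exists s => //; lra.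
have [v1 v1b wv1] := sl y1 y2 (f u2) w y1wy2.
case: v1b => v1b.
  by have [|s sU /weaken] := near2 v1 v1b; [lra|exact].
have [v2 v2b v1v2] := sl (f u2) y1 (f u1) v1 v1b.
have wv2 : mdist w v2 <= 2 * delta by have := metric_triangle w v1 v2; lra.
case: v2b => v2b.
  by have [|s sU /weaken] := near1 v2 v2b; [lra|exact].
(* Two stretches of length at most [2 * D + 2 * delta + 1] and two sides of length at most [D]. *)
have fu12 : mdist (f u1) (f u2) <= 6 * D + 4 * delta + 2.
  have := metric_triangle (f u1) y1 (f u2); have := metric_triangle y1 y2 (f u2).
  have := metric_triangle y1 w y2.
  by rewrite [mdist (f u1) y1]metric_sym [mdist w y2]metric_sym; lra.
have [s /andP[s0 sU] v2s] : exists2 s, 0 <= s <= U & mdist v2 (f s) <= delta * N%:R + 1.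
  have aux s t : 0 <= s -> s <= t -> t <= U -> mdist (f s) (f t) <= 6 * D + 4 * delta + 2 ->
      between (f s) v2 (f t) ->
      exists2 u, 0 <= u <= U & mdist v2 (f u) <= delta * N%:R + 1.
    move=> s0 st tU fst vb; have [_ q2] := qf s t s0 st tU.
    have [|||u /andP[su ut] vu] := @path_near_log delta C f N s t v2 sl _ _ _ vb => //.
    - move=> a b sa ab bt.
      have [] // := qf a b (le_trans s0 sa) ab (le_trans bt tU).
    - apply: le_trans DN; apply: ler_wpM2l => //; lra.
    - by exists u => //; rewrite (le_trans s0 su) (le_trans ut tU).
  (* Nearby points chosen independently may come in either order along [f]. *)
  case: (leP u1 u2) => [u12|/ltW u21].
    by apply: (aux u1 u2) => //; exact: v2b.
  by apply: (aux u2 u1) => //; [rewrite metric_sym | exact/between_sym].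
exists s; first by rewrite s0.
by have := metric_triangle w v2 (f s); lra.
Qed.

End QuasiGeodesics.

(** With [A + 2 * B <= m + 1], the threshold [2 * m] works since [2 ^+ (2 * m)] is at least the
    square of [m + 1]; beyond it each doubling gains at least [m + 1 >= B]. *)
Lemma linear_le_exp2 (R : realType) (A B : R) : 0 <= A -> 0 <= B ->
  exists N0 : nat, forall n, (N0 <= n)%N -> A + B * n%:R <= 2 ^+ n.
Proof.
move=> A0 B0; pose m := Num.truncn (A + 2 * B).
have Am : A + 2 * B <= m.+1%:R by rewrite ltW// truncnS_gt.
have m2 : m.+1%:R <= 2 ^+ m :> R by rewrite -natrX ler_nat ltn_expl.
have m1 : 1 <= m.+1%:R :> R by rewrite ler1n.
have A1 : B <= m.+1%:R by lra.
exists (2 * m)%N; elim=> [|n IH].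
  rewrite leqn0 muln_eq0/= => /eqP m0; move: Am; rewrite m0 expr0; lra.
rewrite leq_eqVlt => /predU1P[<-|].
  rewrite mul2n -addnn exprD natrD.
  apply: le_trans (_ : m.+1%:R * m.+1%:R <= _); last by apply: ler_pM; lra.
  have mm : m%:R * (2 * B) <= m%:R * m.+1%:R by apply: ler_wpM2l => //; lra.
  by rewrite -{1}natr1 mulrDl mul1r; lra.
rewrite ltnS => mn; have := IH mn.
have : 2 ^+ m <= 2 ^+ n :> R.
  by rewrite ler_weXn2l ?ler1n// (leq_trans _ mn)// leq_pmull.
rewrite exprS -[n.+1%:R]natr1; lra.
Qed.

(* By [fellow_step] a bound [D] improves to one logarithmic in [D]; iterating, any
   bound descends to a threshold depending only on the constants. *)
Lemma morse (R : realType) (delta C C' : R) :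
  0 <= delta -> 0 <= C -> 0 <= C' -> exists2 H, 0 <= H &
  forall (K : metricType R) (f : R -> K) (U : R), slim K delta -> divisible K ->
    0 <= U -> quasi_geodesic C C' U f -> fellow U f H.
Proof.
move=> d0 C0 C'0; pose D n : R := 2 * delta + (delta * n%:R + 1).
have D0 n : 0 <= D n by rewrite !addr_ge0// mulr_ge0.
(* These coefficients come from expanding [C * (6 * D n.+1 + 4 * delta + 2 + C')] in [n]. *)
have [||N0 HN0] := @linear_le_exp2 R (C * (22 * delta + 8 + C')) (6 * C * delta).
- by rewrite mulr_ge0// !addr_ge0// mulr_ge0.
- by rewrite !mulr_ge0.
exists (D N0) => // K f U sl dv U0 qf.
have descend n : (N0 <= n)%N -> fellow U f (D n.+1) -> fellow U f (D n).
  move=> Nn; apply: (fellow_step sl dv d0 C0 U0 qf (D0 _)).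
  by apply: le_trans (HN0 n Nn); rewrite /D -natr1; lra.
have descends n : fellow U f (D (N0 + n)%N) -> fellow U f (D N0).
  elim: n => [|n IH]; first by rewrite addn0.
  by rewrite addnS => fn; apply/IH/descend => //; exact: leq_addr.
(* The trivial bound [E] need not have the form [D n]; one application of [fellow_step] turns it
   into such a bound. *)
pose E := mdist (f 0) (f U).
pose B := C * (6 * E + 4 * delta + 2 + C').
have E0 : 0 <= E := mdist_ge0 _ _.
have B0 : 0 <= B by rewrite mulr_ge0// !addr_ge0// mulr_ge0.
have [n0 Hn0] := linear_le_exp2 B0 (lexx 0).
apply: (descends n0); apply: (fellow_step sl dv d0 C0 U0 qf E0).
  by have := Hn0 (N0 + n0)%N (leq_addl _ _); rewrite mul0r addr0.
move=> w wb; exists 0; first by rewrite lexx.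
by rewrite metric_sym /E -wb lerDl mdist_ge0.
Qed.

(* [f] is a quasigeodesic because the 1-Lipschitz function [h] grows at unit rate
   along it; the growth passes to the geodesic fellow-travelling [f]. *)
Lemma geodesic_growth (R : realType) (delta C C' : R) :
  0 <= delta -> 1 <= C -> 0 <= C' -> exists2 A, 0 <= A &
  forall (K : metricType R) (h : K -> R) (f : R -> K) (U b : R) (g : R -> K),
    slim K delta -> divisible K -> (forall u v, h u - h v <= mdist u v) ->
    0 <= U ->
    (forall u v, 0 <= u -> u <= v -> v <= U -> mdist (f u) (f v) <= C * (v - u)) ->
    (forall u, 0 <= u <= U -> b + u - C' <= h (f u) <= b + u) ->
    is_geodesic (f 0) (f U) g ->
    forall t1 t2, 0 <= t1 -> t1 <= t2 -> t2 <= mdist (f 0) (f U) ->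
    h (g t1) <= h (g t2) + A - (t2 - t1) / C.
Proof.
move=> d0 C1 C'0; have C0 : 0 <= C by lra.
have [H H0 mor] := morse d0 C0 C'0.
(* The error [2 * H + delta] enters twice: through the values of [h], and in comparing [t2 - t1]
   with [u2 - u1]. *)
exists (C' + 4 * H + 2 * delta).
  by rewrite !addr_ge0// mulr_ge0.
move=> K h f U b g sl dv hL U0 fL hf gg t1 t2 t10 t12 t2D.
have qf : quasi_geodesic C C' U f.
  move=> u v u0 uv vU; split; first exact: fL.
  have /andP[h1 h2] : b + u - C' <= h (f u) <= b + u by rewrite hf// u0 (le_trans uv).
  have /andP[h3 h4] : b + v - C' <= h (f v) <= b + v by rewrite hf// vU (le_trans u0).
  by have := hL (f v) (f u); rewrite metric_sym; lra.
have t1D := le_trans t12 t2D; have t20 := le_trans t10 t12.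
have [b1 _] : between (f 0) (g t1) (f U) /\ mdist (f 0) (g t1) = t1.
  by apply: geodesic_between; rewrite // t10.
have [b2 e2] : between (f 0) (g t2) (f U) /\ mdist (f 0) (g t2) = t2.
  by apply: geodesic_between; rewrite // t20.
have e1 : mdist (f 0) (g t1) = t1.
  by have [] := geodesic_between gg (t := t1); rewrite ?t10.
have b12 : between (f 0) (g t1) (g t2).
  by rewrite /between e1 e2 (geodesic_mdist gg)// addrC subrK.
have [u2 /andP[u20 u2U] gu2] := mor K f U sl dv U0 qf _ b2.
(* To secure [u1 <= u2], slimness of the triangle [f 0], [g t2], [f u2] leads either to [u2] itself
   or to the geodesic subtending the piece of [f] up to [u2], where [mor] is applied. *)
have [u1 /andP[u10 u12] gu1] : exists2 u1, 0 <= u1 <= u2 & mdist (g t1) (f u1) <= delta + H.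
  have [v [vb|/between_sym vb] gv] := sl _ _ (f u2) _ b12.
    exists u2; first by rewrite u20 lexx.
    have := metric_triangle (g t1) v (f u2); have := mdist_ge0 (g t2) v.
    by move: vb; rewrite /between; lra.
  have [u1 u1I vu1] := mor K f u2 sl dv u20 (quasi_geodesic_le u2U qf) _ vb.
  by exists u1 => //; have := metric_triangle (g t1) v (f u1); lra.
have u1U := le_trans u12 u2U.
have /andP[_ h1] : b + u1 - C' <= h (f u1) <= b + u1 by rewrite hf// u10.
have /andP[h2 _] : b + u2 - C' <= h (f u2) <= b + u2 by rewrite hf// u20.
have h3 := hL (g t1) (f u1); have h4 := hL (f u2) (g t2).
have t21 : t2 - t1 <= 2 * H + delta + C * (u2 - u1).
  rewrite -(geodesic_mdist gg)//.
  have := metric_triangle (g t1) (f u1) (g t2).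
  have := metric_triangle (f u1) (f u2) (g t2); have := fL u1 u2 u10 u12 u2U.
  by rewrite [mdist (f u2) (g t2)]metric_sym; lra.
suff : (t2 - t1) / C <= 2 * H + delta + (u2 - u1).
  by move: h4; rewrite metric_sym; lra.
rewrite ler_pdivrMr; last by lra.
apply: le_trans t21 _; rewrite [leRHS]mulrDl [(u2 - u1) * C]mulrC lerD2r.
by rewrite ler_peMr// addr_ge0// mulr_ge0.
Qed.

(** * Length of curves *)

Section CurveLength.
Variables (R : realType) (T : metricType R) (g : R -> T).
Implicit Types (a b c s t : R) (p : seq R).

(** The sum in [curve_length], made recursive so that induction peels off the first chord. *)
Fixpoint chord_sum a p : R :=
  if p is x :: p' then mdist (g a) (g x) + chord_sum x p' else 0.

Lemma chord_sumE a b p :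
  \sum_(0 <= n < size p) mdist (g (nth b (a :: p) n)) (g (nth b (a :: p) n.+1))
  = chord_sum a p.
Proof.
elim: p a => [|x p IH] a /=; first by rewrite big_nil.
by rewrite big_nat_recl//= -IH.
Qed.

Lemma chord_sum_cat a p q :
  chord_sum a (p ++ q) = chord_sum a p + chord_sum (last a p) q.
Proof. by elim: p a => [|x p IH] a /=; rewrite ?add0r// IH addrA. Qed.

Lemma itv_partition_consE a b x p :
  itv_partition a b (x :: p) <-> a < x /\ itv_partition x b p.
Proof.
rewrite /itv_partition /=; split=> [[/andP[ax xp] xb]|[ax [xp xb]]] //.
by split=> //; rewrite ax.
Qed.

Lemma chord_sum_le_length a b p :
  itv_partition a b p -> ((chord_sum a p)%:E <= curve_length g a b)%E.
Proof. by move=> pp; apply: ereal_sup_ubound; exists p; rewrite ?chord_sumE. Qed.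

Lemma curve_length_le a b (r : \bar R) :
  (forall p, itv_partition a b p -> ((chord_sum a p)%:E <= r)%E) ->
  (curve_length g a b <= r)%E.
Proof.
by move=> H; apply/ereal_supP => _ [p pp <-]; rewrite chord_sumE; exact: H.
Qed.

Lemma mdist_le_curve_length a b :
  a <= b -> ((mdist (g a) (g b))%:E <= curve_length g a b)%E.
Proof.
rewrite le_eqVlt => /predU1P[->|ab].
  by rewrite mdistxx; apply: (@chord_sum_le_length b b [::]); split=> //=.
have /= := chord_sum_le_length (itv_partition1 ab).
by rewrite addr0.
Qed.

Lemma curve_length_ge0 a b : a <= b -> (0 <= curve_length g a b)%E.
Proof.
by move=> /mdist_le_curve_length; apply: le_trans; rewrite lee_fin mdist_ge0.
Qed.

Lemma curve_lengthxx a : curve_length g a a = 0%E.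
Proof.
apply/le_anti/andP; split; last exact: curve_length_ge0.
by apply: curve_length_le => p /itv_partitionxx ->.
Qed.

(** Partitions of adjacent intervals concatenate; the supremum is taken over those of the second
    interval, then over those of the first. *)
Lemma curve_length_superadditive a b c : a <= b -> b <= c ->
  (curve_length g a b + curve_length g b c <= curve_length g a c)%E.
Proof.
move=> ab bc; have := curve_length_ge0 (le_trans ab bc).
case E : (curve_length g a c) => [r| |] // _; last exact: leey.
have key p q : itv_partition a b p -> itv_partition b c q ->
    chord_sum a p + chord_sum b q <= r.
  move=> pp qq; have [_ /eqP lp] := pp.
  have := chord_sum_le_length (itv_partition_cat pp qq).
  by rewrite E lee_fin chord_sum_cat lp.
have bcp p : itv_partition a b p -> (curve_length g b c <= (r - chord_sum a p)%:E)%E.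
  move=> pp; apply: curve_length_le => q qq.
  by rewrite lee_fin lerBrDl key.
have [p0 pp0] : exists p, itv_partition a b p.
  move: ab; rewrite le_eqVlt => /predU1P[->|ab]; last by exists [:: b]; exact: itv_partition1.
  by exists [::]; split=> /=.
move: (curve_length_ge0 bc) (bcp p0 pp0) (bcp).
case: (curve_length g b c) => [l| |] // _ _ {}bcp.
rewrite -leeBrDr// -EFinB; apply: curve_length_le => p /bcp.
by rewrite !lee_fin lerBrDr lerBrDl.
Qed.

Lemma curve_length_subadditive a b c : a <= b -> b <= c ->
  (curve_length g a c <= curve_length g a b + curve_length g b c)%E.
Proof.
move=> ab bc; apply: curve_length_le => p.
elim: p a ab => [|x p IH] a ab.
  move=> _ /=; exact: adde_ge0 (curve_length_ge0 ab) (curve_length_ge0 bc).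
move=> /itv_partition_consE[ax xp] /=; rewrite EFinD.
(* A chord that jumps over [b] is split there by the triangle inequality; otherwise the induction
   continues from [x]. *)
case: (leP x b) => xb.
  apply: (le_trans (leeD2l _ (IH x xb xp))).
  rewrite addeA leeD2r//.
  apply: le_trans (curve_length_superadditive (ltW ax) xb).
  by rewrite leeD2r// mdist_le_curve_length// ltW.
have H : (((mdist (g b) (g x) + chord_sum x p)%:E) <= curve_length g b c)%E.
  have /chord_sum_le_length : itv_partition b c (x :: p) by apply/itv_partition_consE.
  by [].
apply: le_trans (leeD (mdist_le_curve_length ab) H).
by rewrite -!EFinD lee_fin addrA lerD2r metric_triangle.
Qed.

(** Prepares one-sided continuity of arc length: within the first interval of the partition, moving
    the start to [t] costs only the chord from [g a] to [g t]. *)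
Lemma chord_sum_cut_first a b p : a < b -> itv_partition a b p ->
  exists2 c, a < c <= b & forall t, a < t < c ->
  ((chord_sum a p)%:E <= (mdist (g a) (g t))%:E + curve_length g t b)%E.
Proof.
case: p => [ab [_ /= /eqP e]|x p ab /itv_partition_consE[ax xp]].
  by move: ab; rewrite e ltxx.
exists x; first by rewrite ax (itv_partition_le xp).
move=> t /andP[a_t tx].
have /chord_sum_le_length /= H : itv_partition t b (x :: p) by apply/itv_partition_consE.
apply: le_trans (leeD2l _ H); rewrite -EFinD lee_fin addrA lerD2r.
exact: metric_triangle.
Qed.

Lemma chord_sum_cut_last a b p : a < b -> itv_partition a b p ->
  exists2 c, a <= c < b & forall t, c < t < b ->
  ((chord_sum a p)%:E <= curve_length g a t + (mdist (g t) (g b))%:E)%E.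
Proof.
elim: p a => [|x p IH] a ab.
  by move=> [_ /= /eqP e]; move: ab; rewrite e ltxx.
move=> /itv_partition_consE[ax xp] /=.
have := itv_partition_le xp; rewrite le_eqVlt => /predU1P[xb|xb].
  exists a; first by rewrite lexx.
  move: xp; rewrite xb => /itv_partitionxx -> /= t /andP[a_t tb].
  apply: le_trans (leeD2r _ (mdist_le_curve_length (ltW a_t))).
  by rewrite addr0 -EFinD lee_fin metric_triangle.
have [c /andP[xc cb] H] := IH x xb xp.
exists c; first by rewrite cb (le_trans (ltW ax)).
move=> t /andP[ct tb]; have xt := le_trans xc (ltW ct).
rewrite EFinD; apply: le_trans (leeD2l _ (H t _)) _; first by rewrite ct.
rewrite addeA leeD2r//; apply: le_trans (curve_length_superadditive (ltW ax) xt).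
by rewrite leeD2r// mdist_le_curve_length// ltW.
Qed.

Lemma curve_length_adherent a b (l e : R) : 0 < e ->
  curve_length g a b = l%:E -> exists2 p, itv_partition a b p & l - e < chord_sum a p.
Proof.
move=> e0 lE; apply: contrapT => H.
have : (curve_length g a b <= (l - e)%:E)%E.
  apply: curve_length_le => p pp; rewrite lee_fin leNgt; apply/negP => lp.
  by apply: H; exists p.
by rewrite lE lee_fin; lra.
Qed.

End CurveLength.

Lemma curve_length_shift (R : realType) (T : metricType R) (g : R -> T) (c t : R) :
  (curve_length (fun r => g (c + r)%R) 0%R t <= curve_length g c (c + t)%R)%E.
Proof.
apply: curve_length_le => p pp.
have : itv_partition (c + 0) (c + t) [seq c + x | x <- p].
  move: pp => [pp /eqP pt]; split; last by rewrite last_map pt.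
  by rewrite path_map; apply: sub_path pp => x y /=; rewrite ltrD2l.
rewrite addr0 => /(chord_sum_le_length g); apply: le_trans; rewrite lee_fin.
rewrite -{2}[c]addr0; elim: p {pp} 0 => [|x p IH] r //=.
by rewrite lerD2l IH.
Qed.

(** * Arc length along a rectifiable curve and reparametrization by it *)

Section RectifiableCurve.
Variables (R : realType) (T : metricType R) (g : R -> T) (L : R).
Hypotheses (L0 : 0 <= L) (cg : {within `[0, L], continuous g})
  (rg : (curve_length g 0 L < +oo)%E).
Implicit Types s t : R.

Definition arclength t : R := fine (curve_length g 0 t).

Lemma arclengthE t : 0 <= t <= L -> curve_length g 0 t = (arclength t)%:E.
Proof.
move=> /andP[t0 tL]; rewrite fineK// ge0_fin_numE ?curve_length_ge0//.
apply: le_lt_trans rg; apply: le_trans (curve_length_superadditive g t0 tL).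
by rewrite leeDl// curve_length_ge0.
Qed.

Lemma arclength0 : arclength 0 = 0.
Proof. by rewrite /arclength curve_lengthxx. Qed.

Lemma arclengthB s t : 0 <= s -> s <= t -> t <= L ->
  curve_length g s t = (arclength t - arclength s)%:E.
Proof.
move=> s0 st tL; have sL := le_trans st tL; have t0 := le_trans s0 st.
have := curve_length_superadditive g s0 st.
have := curve_length_subadditive g s0 st.
rewrite !arclengthE ?s0 ?t0//; case: (curve_length g s t) => [l| |]//.
rewrite -EFinD !lee_fin => h1 h2; congr _%:E; lra.
Qed.

Lemma mdist_le_arclength s t : 0 <= s -> s <= t -> t <= L ->
  mdist (g s) (g t) <= arclength t - arclength s.
Proof.
by move=> s0 st tL; rewrite -lee_fin -arclengthB// mdist_le_curve_length.
Qed.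

Lemma le_arclength s t : 0 <= s -> s <= t -> t <= L -> arclength s <= arclength t.
Proof.
by move=> s0 st tL; rewrite -subr_ge0; apply: le_trans (mdist_le_arclength s0 st tL);
  exact: mdist_ge0.
Qed.

Lemma curve_near t e : 0 <= t <= L -> 0 < e -> exists2 d, 0 < d &
  forall s, 0 <= s <= L -> `|t - s| < d -> mdist (g t) (g s) < e.
Proof.
move=> tL e0; move/subspace_continuousP: cg => /(_ t).
rewrite /= in_itv/= tL => /(_ isT)/metricType_numDomainType.cvgrPdist_lt/(_ e e0).
rewrite near_withinE => /nbhs_ballP[d /= d0 H]; exists d => // s sL ts.
by apply: H => //=; rewrite in_itv.
Qed.

(** Cut a partition of [[t, L]] that is optimal up to [e / 2] at a point [s] close to [t]. The chord
    lost is shorter than [e / 2] by continuity of [g], so the piece from [t] to [s] has length at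
    most [e]. *)
Lemma arclength_right t e : 0 <= t < L -> 0 < e ->
  exists2 s, t < s <= L & arclength s <= arclength t + e.
Proof.
move=> /andP[t0 tL] e0; have e2 : 0 < e / 2 by rewrite divr_gt0.
have lE := arclengthB t0 (ltW tL) (lexx L).
have [p pp lp] := curve_length_adherent e2 lE.
have [c /andP[tc cL] cut] := chord_sum_cut_first g tL pp.
have [|d d0 near] := @curve_near t _ _ e2; first by rewrite t0 ltW.
pose s := Num.min ((t + c) / 2) (t + d / 2).
have ts : t < s by rewrite lt_min; apply/andP; split; lra.
have sc : s < c by rewrite gt_min; apply/orP; left; lra.
have sd : s < t + d by rewrite gt_min; apply/orP; right; lra.
have sL : s <= L by rewrite (le_trans (ltW sc)).
have s0 : 0 <= s by rewrite (le_trans t0) ?ltW.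
exists s; first by rewrite ts.
have gts : mdist (g t) (g s) < e / 2.
  by apply: near; rewrite ?s0// distrC gtr0_norm; lra.
have := cut s; rewrite ts sc arclengthB// -EFinD lee_fin => /(_ isT); lra.
Qed.

Lemma arclength_left t e : 0 < t <= L -> 0 < e ->
  exists2 s, 0 <= s < t & arclength t <= arclength s + e.
Proof.
move=> /andP[t0 tL] e0; have e2 : 0 < e / 2 by rewrite divr_gt0.
have lE := arclengthE (t := t); rewrite (ltW t0) in lE.
have [p pp lp] := curve_length_adherent e2 (lE tL).
have [c /andP[c0 ct] cut] := chord_sum_cut_last g t0 pp.
have [|d d0 near] := @curve_near t _ _ e2; first by rewrite ltW.
pose s := Num.max ((t + c) / 2) (t - d / 2).
have st : s < t by rewrite gt_max; apply/andP; split; lra.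
have cs : c < s by rewrite lt_max; apply/orP; left; lra.
have ds : t - d < s by rewrite lt_max; apply/orP; right; lra.
have s0 : 0 <= s by rewrite (le_trans c0) ?ltW.
have sL : s <= L by rewrite (le_trans (ltW st)).
exists s; first by rewrite s0.
have gts : mdist (g t) (g s) < e / 2.
  by apply: near; rewrite ?s0// gtr0_norm; lra.
have := cut s; rewrite st cs (arclengthE (t := s)) ?s0// -EFinD lee_fin => /(_ isT).
by rewrite metric_sym; lra.
Qed.

(** Intermediate values via a supremum: [arclength_left] excludes overshooting [s],
    [arclength_right] excludes falling short. *)
Lemma arclength_surj s : 0 <= s <= arclength L ->
  exists2 t, 0 <= t <= L & arclength t = s.
Proof.
move=> /andP[s0 sL].
pose A := [set t | 0 <= t <= L /\ arclength t <= s].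
have A0 : A 0 by rewrite /A/= lexx L0 arclength0.
have hA : has_sup A by split; [exists 0|exists L => t [/andP[]]].
have uA : has_ubound A by case: hA.
pose t := sup A.
have t0 : 0 <= t by apply: ub_le_sup.
have tL : t <= L by apply: ge_sup; [exists 0|move=> r [/andP[]]].
exists t; first by rewrite t0.
apply/le_anti/andP; split; rewrite leNgt; apply/negP => st.
- have tpos : 0 < t.
    rewrite lt_neqAle t0 andbT; apply/eqP => t00.
    by move: st; rewrite -t00 arclength0; lra.
  have [||r /andP[r0 rt] tr] := @arclength_left t ((arclength t - s) / 2).
  + by rewrite tpos.
  + by lra.
  have [|q [/andP[q0 qL] qs] rq] := @sup_adherent _ A (t - r) _ hA.
  + by rewrite subr_gt0.
  have := le_arclength r0 (s := r) (t := q); rewrite -/t in rq; lra.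
- have tL' : t < L.
    rewrite lt_neqAle tL andbT; apply/eqP => tLe.
    by move: st; rewrite tLe; lra.
  have [||r /andP[tr rL] rs] := @arclength_right t (s - arclength t).
  + by rewrite t0.
  + by lra.
  have : r <= t.
    apply: ub_le_sup => //; split; first by rewrite rL (le_trans t0)// ltW.
    by lra.
  lra.
Qed.

Lemma mdist_le_arclength_dist s t : 0 <= s <= L -> 0 <= t <= L ->
  mdist (g s) (g t) <= `|arclength s - arclength t|.
Proof.
move=> /andP[s0 sL] /andP[t0 tL]; case: (leP s t) => [|/ltW] st.
  rewrite distrC; exact: le_trans (mdist_le_arclength s0 st tL) (ler_norm _).
by rewrite metric_sym; exact: le_trans (mdist_le_arclength t0 st sL) (ler_norm _).
Qed.

(** Equal arc lengths force equal points, so the choice made by [xget] is immaterial; [t] witnesses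
    that the set is inhabited, so the default is not invoked. *)
Lemma arclength_paramE t : 0 <= t <= L -> arclength_param g L (arclength t) = g t.
Proof.
move=> tI; rewrite /arclength_param; set A := [set _ | _].
have [] : A (xget 0 A) by apply: xgetPex; exists t; split=> //; exact: arclengthE.
move: (xget 0 A) => r rI; rewrite arclengthE// => -[rt].
apply: mdist_positivity; apply/le_anti; rewrite mdist_ge0 andbT.
by apply: le_trans (mdist_le_arclength_dist rI tI) _; rewrite rt subrr normr0.
Qed.

Lemma mdist_arclength_param s t : 0 <= s <= arclength L -> 0 <= t <= arclength L ->
  mdist (arclength_param g L s) (arclength_param g L t) <= `|s - t|.
Proof.
move=> /arclength_surj[p pI <-] /arclength_surj[q qI <-].
by rewrite !arclength_paramE//; exact: mdist_le_arclength_dist.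
Qed.

End RectifiableCurve.

(** * Path integrals and the quasihyperbolic metric *)

Lemma integral_inv_shift (R : realType) (c l : R) : 0 < c -> 0 <= l ->
  (\int[lebesgue_measure]_(s in `[0%R, l]) ((c + s)^-1)%:E = (ln ((c + l) / c))%:E)%E.
Proof.
move=> c0; rewrite le_eqVlt => /predU1P[<-|l0].
  by rewrite set_itv1 integral_set1 addr0 divff ?gt_eqF// ln1.
have cx (x : R) : 0 <= x -> 0 < c + x by move=> x0; rewrite ltr_wpDr.
have dF (x : R) : 0 <= x -> is_derive x 1 (fun s : R => ln (c + s)) (c + x)^-1.
  move=> x0; have H := is_derive1_ln (cx x x0).
  have H2 : is_derive x 1 (fun s : R => c + s) 1.
    by have := is_deriveD (is_derive_cst c x 1) (is_derive_id x 1); rewrite add0r.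
  by have := @is_derive1_comp R (@ln R) (fun s => c + s) x _ _ H H2; rewrite mulr1.
have cF (x : R) : 0 <= x -> {for x, continuous (fun s => ln (c + s))}.
  move=> x0; have [d _] := dF x x0.
  by apply/differentiable_continuous/derivable1_diffP.
rewrite (@continuous_FTC2 _ _ (fun s => ln (c + s)) _ _ l0); last first.
- move=> x; rewrite in_itv/= => /andP[x0 _]; rewrite derive1E.
  by have [_ ->] := dF x (ltW x0).
- split.
  + by move=> x; rewrite in_itv/= => /andP[x0 _]; have [] := dF x (ltW x0).
  + exact/cvg_at_right_filter/cF.
  + by apply/cvg_at_left_filter/cF; exact: ltW.
- apply: continuous_in_subspaceT => x; rewrite inE/= in_itv/= => /andP[x0 _].
  apply: cvgV; first by rewrite gt_eqF// cx.
  by apply: cvgD; [exact: cvg_cst|exact: cvg_id].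
by rewrite addr0 -EFinB -ln_div// ?posrE// cx// ltW.
Qed.

Section PathIntegral.
Variables (R : realType) (T : metricType R) (rho : T -> R) (g : R -> T) (L : R).
Hypotheses (rho0 : forall z, 0 < rho z)
  (rhoL : forall z w, rho z <= rho w + mdist z w)
  (L0 : 0 <= L) (cg : {within `[0, L], continuous g})
  (rg : (curve_length g 0 L < +oo)%E).

Let l := arclength g L.
Let phi (s : R) : R := rho (arclength_param g L s).

Let l0 : 0 <= l.
Proof. by have := le_arclength rg (lexx 0) L0 (lexx L); rewrite arclength0. Qed.

Let measurable_inv_phi :
  measurable_fun `[0, l] (fun s => ((phi s)^-1)%:E).
Proof.
apply/measurable_EFinP; apply: subspace_continuous_measurable_fun => //.
(* Both [rho] and the arc-length parametrization are 1-Lipschitz, hence so is [phi]. *)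
apply/subspace_continuousP => s /=; rewrite in_itv/= => sl.
apply: cvgV; first by rewrite gt_eqF//; exact: rho0.
apply/cvgrPdist_lt => e e0; rewrite near_withinE; apply/nbhs_ballP.
exists e => //= r rs /[!in_itv]/= rl.
apply: le_lt_trans rs; have := mdist_arclength_param L0 cg rg sl rl.
rewrite ler_norml lerBlDr.
have := rhoL (arclength_param g L s) (arclength_param g L r).
have := rhoL (arclength_param g L r) (arclength_param g L s).
by rewrite /phi [mdist (arclength_param g L r) _]metric_sym => *;
  apply/andP; split; lra.
Qed.

Let measurable_inv_shift (c : R) : 0 < c ->
  measurable_fun `[0, l] (fun s => ((c + s)^-1)%:E).
Proof.
move=> c0.
apply/measurable_EFinP; apply: subspace_continuous_measurable_fun => //.
apply: continuous_in_subspaceT => x; rewrite inE/= in_itv/= => /andP[x0 _].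
apply: cvgV; first by rewrite gt_eqF// ltr_wpDr.
by apply: cvgD; [exact: cvg_cst|exact: cvg_id].
Qed.

(** In arc length [s] the integrand dominates [(c + s)^-1], whose integral is the logarithm. Taking
    [c] to be [rho] at the initial point bounds the quasihyperbolic metric from below. *)
Lemma path_integral_ge (c : R) : 0 < c ->
  (forall t, 0 <= t <= L -> rho (g t) <= c + arclength g t) ->
  ((ln ((c + l) / c))%:E <= path_integral (fun z => (rho z)^-1)%R g L)%E.
Proof.
move=> c0 rc; rewrite -integral_inv_shift// /path_integral -/(arclength g L) -/l.
apply: ge0_le_integral => //.
- by move=> s /=; rewrite in_itv/= => /andP[s0 _]; rewrite lee_fin invr_ge0 addr_ge0// ltW.
- exact: measurable_inv_shift.
move=> s /=; rewrite in_itv/= => sl; have /andP[s0 _] := sl.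
rewrite lee_fin lef_pV2 ?posrE ?ltr_wpDr//.
have [t tL <-] := arclength_surj L0 cg rg sl.
by rewrite (arclength_paramE rg)// rc.
Qed.

Lemma path_integral_le (c C : R) : 0 < c -> 0 < C ->
  (forall t, 0 <= t <= L -> c + arclength g t <= C * rho (g t)) ->
  (path_integral (fun z => (rho z)^-1)%R g L <= (C * ln ((c + l) / c))%:E)%E.
Proof.
move=> c0 C0 rc; rewrite EFinM -integral_inv_shift// -ge0_integralZl//; last 3 first.
- by apply: measurable_inv_shift.
- by move=> s /=; rewrite in_itv/= => /andP[s0 _]; rewrite lee_fin invr_ge0 addr_ge0// ltW.
- by rewrite lee_fin ltW.
rewrite /path_integral -/(arclength g L) -/l.
apply: ge0_le_integral => //.
- by move=> s _; rewrite lee_fin invr_ge0 ltW.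
- by apply/measurable_funeM; exact: measurable_inv_shift.
move=> s /=; rewrite in_itv/= => sl; have /andP[s0 _] := sl.
have [t tL tE] := arclength_surj L0 cg rg sl.
have := rc t tL; rewrite -tE (arclength_paramE rg)// => rct.
have cs : 0 < c + arclength g t by rewrite tE ltr_wpDr.
by rewrite -EFinM lee_fin ler_pdivlMr// mulrC ler_pdivrMr.
Qed.

Lemma path_integral_ge0 : (0 <= path_integral (fun z => (rho z)^-1)%R g L)%E.
Proof. by apply: integral_ge0 => s _; rewrite lee_fin invr_ge0 ltW. Qed.

End PathIntegral.

(** * Distance to the metric boundary *)

Section BoundaryDistance.
Variables (R : realType) (X Xbar : metricType R) (iota : X -> Xbar).
Hypotheses (lcX : locally_compact [set: X]) (ncX : ~ complete_space X)
  (cpl : is_completion iota).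
Implicit Types x y z : X.

Let iota_mdist x y : mdist (iota x) (iota y) = mdist x y.
Proof. by case: cpl. Qed.

(** If [iota] were onto, Cauchy filters on [X] would converge after pushing forward to [Xbar], and
    the isometry would pull the limits back, making [X] complete. *)
Lemma metric_boundary_nonempty : metric_boundary iota !=set0.
Proof.
apply: contrapT => noB; apply: ncX => F FF cF.
have surj b : exists x, iota x = b.
  apply: contrapT => nb; apply: noB; exists b => -[x _ xb]; by apply: nb; exists x.
have [compl _ _] := cpl.
have [|b Fb] := compl (iota @ F) _.
  apply/cauchy_ballP => e e0; move/cauchy_ballP: cF => /(_ e e0).
  case=> -[P Q] /= [FP FQ] PQ.
  exists (iota @` P, iota @` Q) => /=.
    by split; rewrite /fmap/=; [move: FP|move: FQ]; apply: filterS => z Pz; exists z.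
  move=> [_ _] /= [[p Pp <-] [q Qq <-]].
  have /= := PQ (p, q) (conj Pp Qq).
  by rewrite !ballEmdist/= iota_mdist.
have [x xb] := surj b; exists x.
apply/metricType_numDomainType.fcvgrPdist_lt => e e0.
move/metricType_numDomainType.cvgrPdist_lt: Fb => /(_ e e0).
by apply: filterS => z; rewrite -xb iota_mdist.
Qed.

Lemma boundary_dist_le x b :
  metric_boundary iota b -> boundary_dist iota x <= mdist (iota x) b.
Proof.
by move=> bB; apply: ge_inf; [exists 0 => _ [c _ <-]; exact: mdist_ge0|exists b].
Qed.

(** Nonemptiness of the boundary makes the infimum genuine; on the empty set [inf] would be [0]. *)
Lemma boundary_dist_ge x r :
  (forall b, metric_boundary iota b -> r <= mdist (iota x) b) ->
  r <= boundary_dist iota x.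
Proof.
move=> H; apply: lb_le_inf.
  by have [b bB] := metric_boundary_nonempty; exists (mdist (iota x) b), b.
by move=> _ [b bB <-]; exact: H.
Qed.

Lemma boundary_dist_lip x y :
  boundary_dist iota x <= boundary_dist iota y + mdist x y.
Proof.
rewrite -lerBlDr; apply: boundary_dist_ge => b bB; rewrite lerBlDr addrC.
apply: le_trans (boundary_dist_le x bB) _.
by rewrite -iota_mdist metric_triangle.
Qed.

(* A compact ball around [x] stays closed in the completion, and [iota] has
   dense range. *)
Lemma boundary_dist_gt0 x : 0 < boundary_dist iota x.
Proof.
have [U] := lcX (x := x) I; rewrite /within/= => nU [cU _].
have /nbhs_ballP[r /= r0 rU] : nbhs x U by apply: filterS nU => z; exact.
apply: (@lt_le_trans _ _ (r / 2)); first by rewrite divr_gt0.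
apply: boundary_dist_ge => b nb; rewrite leNgt; apply/negP => xb; apply: nb.
have ci : continuous iota.
  move=> z; apply/metricType_numDomainType.cvgrPdist_lt => e e0.
  by apply/nbhs_ballP; exists e => //= w; rewrite ballEmdist/= iota_mdist.
have cl : closed (iota @` U).
  apply: compact_closed; first exact: metric_hausdorff.
  by apply: continuous_compact => //; exact: continuous_subspaceT.
suff : (iota @` U) b by case=> z _ zb; exists z.
apply: cl => V /nbhs_ballP[e /= e0 eV].
have [_ _ dn] := cpl.
(* Within [e] of [b] the approximating point lies in [V]; within [r / 2] of [b] its preimage is
   within [r] of [x], hence in [U]. *)
pose m := Num.min e (r / 2).
have m0 : 0 < m by rewrite lt_min e0 divr_gt0.
have [||w [wb [z _ zw]]] := dn (interior (ball b m)).
- by exists b; apply: nbhsx_ballx.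
- exact: open_interior.
have := interior_subset wb; rewrite ballEmdist/= lt_min => /andP[be br].
exists w; split; last by apply: eV; rewrite ballEmdist.
exists z => //; apply: rU; rewrite ballEmdist/= -iota_mdist zw.
have := metric_triangle (iota x) b w; lra.
Qed.

End BoundaryDistance.

(** * Comparison of the quasihyperbolic metric with [d] and with the boundary distance *)

Section QuasihyperbolicMetric.
Variables (R : realType) (X Xbar : metricType R) (iota : X -> Xbar).
Hypotheses (lcX : locally_compact [set: X]) (ncX : ~ complete_space X)
  (cpl : is_completion iota).
Implicit Types x y z : X.

Let rho := boundary_dist iota.
Let rho0 z : 0 < rho z := boundary_dist_gt0 lcX ncX cpl z.
Let rhoL z w : rho z <= rho w + mdist z w := boundary_dist_lip ncX cpl z w.

Let path_integrals x y : set (\bar R) :=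
  [set I : \bar R | exists (L : R) (g : R -> X), rectifiable_curve x y L g /\
    I = path_integral (fun z : X => (boundary_dist iota z)^-1) g L].

Let path_integrals_ge0 x y : (0 <= ereal_inf (path_integrals x y))%E.
Proof.
by apply: le_ereal_inf_tmp => _ [L [g [_ ->]]]; exact: path_integral_ge0.
Qed.

(* Where the infimum is [+oo], [qh_dist] is [0] and [x = y]. *)
Lemma ln_le_qh_dist (hk : is_metric (qh_dist iota)) x y :
  ln (1 + mdist x y / rho x) <= qh_dist iota x y.
Proof.
rewrite [leRHS]/qh_dist.
case E : (ereal_inf _) => [r| |].
- rewrite /= -lee_fin -E; apply: le_ereal_inf_tmp => _ [L [g [[[L0 cg g0 gL] rg] ->]]].
  have H := path_integral_ge rho0 rhoL L0 cg rg (rho0 x).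
  apply: le_trans (H _); last first.
    move=> t /andP[t0 tL]; apply: le_trans (rhoL (g t) x) _; rewrite lerD2l.
    have := mdist_le_arclength rg (lexx 0) t0 tL.
    by rewrite g0 arclength0 subr0 metric_sym.
  have xy := mdist_le_arclength rg (lexx 0) L0 (lexx L).
  rewrite g0 gL arclength0 subr0 in xy.
  rewrite mulrDl divff ?gt_eqF// lee_fin ler_ln ?posrE ?lerD2l.
  + by rewrite ler_pM2r ?invr_gt0.
  + by rewrite ltr_pwDl// divr_ge0// ?mdist_ge0// ltW.
  + by rewrite ltr_pwDl// divr_ge0// ?(le_trans _ xy) ?mdist_ge0// ltW.
- have : qh_dist iota x y = 0 by rewrite /qh_dist E.
  by move/(is_metric_eq hk) => ->; rewrite mdistxx mul0r addr0 ln1.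
- by have := path_integrals_ge0 x y; rewrite /path_integrals E.
Qed.

Lemma mdist_le_qh_dist (hk : is_metric (qh_dist iota)) x y :
  mdist x y <= rho x * (expR (qh_dist iota x y) - 1).
Proof.
have := ln_le_qh_dist hk x y; rewrite -ler_expR lnK; last first.
  by rewrite posrE ltr_pwDl// divr_ge0 ?mdist_ge0// ltW.
by rewrite -lerBrDl ler_pdivrMr// mulrC.
Qed.

(** Since [rho x / rho y <= 1 + mdist x y / rho y], this follows from [ln_le_qh_dist]; it lets
    [ln rho] serve as the function [h] of [geodesic_growth]. *)
Lemma ln_boundary_dist_lip (hk : is_metric (qh_dist iota)) x y :
  ln (rho x) - ln (rho y) <= qh_dist iota x y.
Proof.
rewrite (is_metric_sym hk); apply: le_trans (ln_le_qh_dist hk y x).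
rewrite -ln_div ?posrE// ler_ln ?posrE ?divr_gt0//; last first.
  by rewrite ltr_pwDl// divr_ge0 ?mdist_ge0// ltW.
by rewrite ler_pdivrMr// mulrDl mul1r divfK ?gt_eqF// metric_sym.
Qed.

Lemma qh_dist_le x y (L r : R) (g : R -> X) : rectifiable_curve x y L g ->
  (path_integral (fun z => (rho z)^-1)%R g L <= r%:E)%E -> qh_dist iota x y <= r.
Proof.
move=> rg Ir; have := path_integrals_ge0 x y.
have : (ereal_inf (path_integrals x y) <= r%:E)%E.
  by apply: ge_ereal_inf; eexists; last exact: Ir; exists L, g.
by rewrite /qh_dist -/(path_integrals x y); case: (ereal_inf _).
Qed.

End QuasihyperbolicMetric.

(** * Cone arcs and growing geodesics *)

Section ConeArc.
Variables (R : realType) (X Xbar : metricType R) (iota : X -> Xbar).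
Hypotheses (lcX : locally_compact [set: X]) (ncX : ~ complete_space X)
  (cpl : is_completion iota) (hk : is_metric (qh_dist iota)).
Variables (a : R) (x x0 : X) (L : R) (g : R -> X).
Hypotheses (a1 : 1 <= a) (cone : is_cone_arc iota a x x0 L g).

Let rho := boundary_dist iota.
Let rho0 z : 0 < rho z := boundary_dist_gt0 lcX ncX cpl z.
Let rhoL z w : rho z <= rho w + mdist z w := boundary_dist_lip ncX cpl z w.

Let L0 : 0 <= L. Proof. by case: cone => -[[]]. Qed.
Let cg : {within `[0, L], continuous g}. Proof. by case: cone => -[[]]. Qed.
Let g0 : g 0 = x. Proof. by case: cone => -[[]]. Qed.
Let gL : g L = x0. Proof. by case: cone => -[[]]. Qed.

Let rg : (curve_length g 0 L < +oo)%E.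
Proof.
case: cone => _ /(_ L); rewrite L0 lexx => /(_ isT) H.
exact: le_lt_trans H (ltry _).
Qed.

Let C : R := 1 + 2 * a.

Let C0 : 0 < C. Proof. by have := a1; rewrite /C; lra. Qed.

(** Since [rho x] exceeds [rho (g t)] by at most the arc length, the left side is at most
    [rho (g t)] plus twice the arc length; the cone condition bounds each of the two by
    [a * rho (g t)]. *)
Lemma cone_arc_rho_ge t : 0 <= t <= L -> rho x + arclength g t <= C * rho (g t).
Proof.
move=> tL; have [_ /(_ t tL)] := cone; rewrite (arclengthE rg)// lee_fin -/rho => H.
have /andP[t0 t1] := tL.
have := mdist_le_arclength rg (lexx 0) t0 t1.
rewrite g0 arclength0 subr0 => xt; have := rhoL x (g t); rewrite /C; lra.
Qed.

Lemma cone_arc_rho_le t : 0 <= t <= L -> rho (g t) <= rho x + arclength g t.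
Proof.
move=> /andP[t0 t1]; have := mdist_le_arclength rg (lexx 0) t0 t1.
by rewrite g0 arclength0 subr0 metric_sym; have := rhoL (g t) x; lra.
Qed.

Lemma arclength_ge0 t : 0 <= t <= L -> 0 <= arclength g t.
Proof.
by move=> /andP[t0 t1]; have := le_arclength rg (lexx 0) t0 t1; rewrite arclength0.
Qed.

(** The subarc itself, shifted to start at parameter [0], is the competitor in the infimum;
    [path_integral_le] applies with [c = rho x + arclength g s]. *)
Lemma cone_arc_qh_dist s t : 0 <= s -> s <= t -> t <= L ->
  qh_dist iota (g s) (g t) <=
    C * ln ((rho x + arclength g t) / (rho x + arclength g s)).
Proof.
move=> s0 st tL; pose h r := g (s + r).
have sL : 0 <= s <= L by rewrite s0 (le_trans st).
have lst r : 0 <= r <= t - s ->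
    (curve_length h 0 r <= (arclength g (s + r) - arclength g s)%:E)%E.
  move=> /andP[r0 rt]; rewrite -(arclengthB rg) ?lerDl//; last by lra.
  exact: curve_length_shift.
have tsI : 0 <= t - s <= t - s by rewrite subr_ge0 st lexx.
have hc : (curve_length h 0 (t - s) < +oo)%E by exact: le_lt_trans (lst _ tsI) (ltry _).
have ch : {within `[0, t - s], continuous h}.
  apply/subspace_continuousP => r /=; rewrite in_itv/= => /andP[r0 rt].
  apply/metricType_numDomainType.cvgrPdist_lt => e e0.
  have [|d d0 near] := curve_near cg (t := s + r) _ e0.
    by apply/andP; split; lra.
  rewrite near_withinE; apply/nbhs_ballP; exists d => //= q rq.
  rewrite in_itv/= => /andP[q0 qt]; apply: near.
    by apply/andP; split; lra.
  by move: rq; rewrite opprD addrACA subrr add0r.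
have c0 : 0 < rho x + arclength g s by rewrite ltr_pwDl// arclength_ge0.
have hl r : 0 <= r <= t - s -> arclength h r <= arclength g (s + r) - arclength g s.
  move=> rI; have := lst r rI.
  by rewrite (@arclengthE _ _ h (t - s) hc).
have st' := hl _ tsI; rewrite [s + _]addrC subrK in st'.
have := path_integral_le rho0 rhoL (L := t - s) (g := h) (c := rho x + arclength g s)
  (C := C) _ ch hc c0.
rewrite subr_ge0 => /(_ st) H.
apply: (qh_dist_le lcX ncX cpl (L := t - s) (g := h)).
  split=> //; split=> //; [by rewrite subr_ge0|by rewrite /h addr0|].
  by rewrite /h addrC subrK.
apply: le_trans (H C0 _) _.
  move=> r rI; have := hl r rI; have /andP[r0 rt] := rI.
  have := cone_arc_rho_ge (t := s + r); rewrite addr_ge0//= => H'.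
  have {H'} := H' ltac:(lra); rewrite /h; lra.
have ht0 : 0 <= arclength h (t - s).
  by have := le_arclength hc (lexx 0) (t := t - s); rewrite arclength0; apply=> //; lra.
rewrite lee_fin ler_wpM2l//; first exact: ltW.
rewrite ler_ln ?posrE ?divr_gt0// ?ler_pM2r ?invr_gt0//; lra.
Qed.

(* [p] is the cone arc in the parameter [u = ln ((rho x + s) / rho x)], where [s]
   is arc length. *)
Lemma cone_arc_quasi_geodesic : exists (U : R) (p : R -> X),
  [/\ 0 <= U, p 0 = x, p U = x0,
    forall u v, 0 <= u -> u <= v -> v <= U -> qh_dist iota (p u) (p v) <= C * (v - u) &
    forall u, 0 <= u <= U -> ln (rho x) + u - ln C <= ln (rho (p u)) <= ln (rho x) + u].
Proof.
have C1 : 1 <= C by have := a1; rewrite /C; lra.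
have l0 : 0 <= arclength g L by rewrite arclength_ge0// L0 lexx.
pose U := ln ((rho x + arclength g L) / rho x).
have UE : expR U = (rho x + arclength g L) / rho x by rewrite lnK// posrE divr_gt0// ltr_pwDl.
pose p u := arclength_param g L (rho x * (expR u - 1)).
have U0 : 0 <= U by rewrite ln_ge0// mulrDl divff ?gt_eqF// lerDl divr_ge0// ltW.
have pE u : 0 <= u <= U -> exists t,
    [/\ 0 <= t <= L, rho x + arclength g t = rho x * expR u & p u = g t].
  move=> /andP[u0 uU].
  have sI : 0 <= rho x * (expR u - 1) <= arclength g L.
    apply/andP; split.
      by rewrite mulr_ge0 ?subr_ge0 ?(ltW (rho0 x))// -(@expR0 R) ler_expR.
    rewrite mulrBr mulr1 lerBlDl -[leRHS](divfK (lt0r_neq0 (rho0 x))) -UE mulrC.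
    by rewrite ler_pM2r// ler_expR.
  have [t tI tE] := arclength_surj L0 cg rg sI.
  exists t; split=> //; first by rewrite tE; lra.
  by rewrite /p -tE (arclength_paramE rg).
exists U, p; split=> //.
- by rewrite /p expR0 subrr mulr0 -(arclength0 g) (arclength_paramE rg)// lexx.
- rewrite -gL -(arclength_paramE rg) ?L0 ?lexx//; congr arclength_param.
  by rewrite UE mulrBr mulr1 mulrC divfK ?gt_eqF// addrC addKr.
- move=> u v u0 uv vU.
  have [|s [sI sE ->]] := pE u; first by rewrite u0 (le_trans uv).
  have [|t [tI tE ->]] := pE v; first by rewrite vU (le_trans u0).
  have /andP[s0 sL] := sI; have /andP[t0 tL] := tI.
  have euv : expR u <= expR v by rewrite ler_expR.
  have lst : arclength g s <= arclength g t.
    by rewrite -(lerD2l (rho x)) sE tE ler_pM2l.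
  case: (leP s t) => st.
    apply: le_trans (cone_arc_qh_dist s0 st tL) _.
    rewrite tE sE -mulf_div divff ?gt_eqF// mul1r -expRB expRK.
    by [].
  (* The parameters found for [u <= v] may come in reverse order; the stretch between them then has
     zero length. *)
  have gst : g s = g t.
    have e : arclength g s = arclength g t.
      by apply/le_anti; rewrite lst (le_arclength rg)// ltW.
    by rewrite -(arclength_paramE rg sI) e (arclength_paramE rg).
  by rewrite gst (is_metric_xx hk) mulr_ge0 ?subr_ge0// ltW.
- move=> u uI; have [t [tI tE ->]] := pE u uI.
  have lE : ln (rho x * expR u) = ln (rho x) + u by rewrite lnM ?posrE ?expR_gt0// expRK.
  apply/andP; split.
    rewrite -lE -tE lerBlDl -lnM ?posrE//.
    rewrite ler_ln ?posrE ?cone_arc_rho_ge//.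
      by rewrite ltr_pwDl// arclength_ge0.
    by rewrite mulr_gt0.
  rewrite -lE -tE ler_ln ?posrE ?cone_arc_rho_le//.
  by rewrite ltr_pwDl// arclength_ge0.
Qed.

End ConeArc.

(** Increments of [F] telescope along every partition. *)
Lemma curve_length_le_increment (R : realType) (T : metricType R) (g : R -> T)
    (F : R -> R) (b c : R) :
  (forall s t, b <= s -> s <= t -> t <= c -> mdist (g s) (g t) <= F t - F s) ->
  (curve_length g b c <= (F c - F b)%:E)%E.
Proof.
move=> gF; apply: curve_length_le => p.
elim: p b gF => [|y p IH] b gF /=.
  by move=> [_ /= /eqP ->]; rewrite subrr.
move=> /itv_partition_consE[b_y yp]; rewrite lee_fin.
have := IH y _ yp; rewrite lee_fin => H.
have := gF b y (lexx b) (ltW b_y) (itv_partition_le yp).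
have : chord_sum g y p <= F c - F y.
  by apply: H => s t ys; apply: gF; exact: le_trans (ltW b_y) ys.
lra.
Qed.

(** * Length of a geodesic along which [rho] grows exponentially *)

Section GrowingGeodesic.
Variables (R : realType) (T : metricType R) (rho : T -> R) (g : R -> T).
Variables (A C L : R).
Hypotheses (C1 : 1 <= C) (rho0 : forall z, 0 < rho z)
  (gd : forall s t, 0 <= s -> s <= t -> t <= L ->
    mdist (g s) (g t) <= rho (g s) * (expR (t - s) - 1))
  (growth : forall s t, 0 <= s -> s <= t -> t <= L ->
    ln (rho (g s)) <= ln (rho (g t)) + A - (t - s) / C).

Let C0 : 0 < C := lt_le_trans ltr01 C1.

(* The primitive of the bound [e * expR A * rho (g t) * expR ((s - t) / C)] on
   the local Lipschitz constant of [g] at [s]. *)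
Definition growth_primitive t s : R :=
  expR 1 * C * expR A * rho (g t) * expR ((s - t) / C).

Lemma rho_growth s t : 0 <= s -> s <= t -> t <= L ->
  rho (g s) <= expR A * rho (g t) * expR ((s - t) / C).
Proof.
move=> s0 st tL; have := growth s0 st tL; rewrite -ler_expR lnK ?posrE//.
by rewrite expRD expRD lnK ?posrE// -mulNr opprB [rho (g t) * _]mulrC.
Qed.

(** On steps of length at most 1, [expR (r - s) - 1 <= expR 1 * (r - s)], which is the source of the
    factor [expR 1]. By convexity the primitive increases by at least its derivative at [s] times
    [r - s]. *)
Lemma mdist_growth_local s r t : 0 <= s -> s <= r -> r <= t -> t <= L ->
  r - s <= 1 -> mdist (g s) (g r) <= growth_primitive t r - growth_primitive t s.
Proof.
move=> s0 sr rt tL rs1; have st := le_trans sr rt.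
apply: le_trans (gd s0 sr (le_trans rt tL)) _.
have rs0 : 0 <= r - s by rewrite subr_ge0.
have e1 : expR (r - s) - 1 <= expR 1 * (r - s).
  have h : 1 - expR (- (r - s)) <= r - s by have := expR_ge1Dx (- (r - s)); lra.
  have -> : expR (r - s) - 1 = expR (r - s) * (1 - expR (- (r - s))).
    by rewrite mulrBr mulr1 -expRD subrr expR0.
  apply: le_trans (_ : expR (r - s) * (r - s) <= _).
    by rewrite ler_pM2l ?expR_gt0.
  by rewrite ler_wpM2r// ler_expR.
set D := expR A * rho (g t) * expR ((s - t) / C).
have D0 : 0 < D by rewrite !mulr_gt0 ?expR_gt0.
have -> : growth_primitive t r - growth_primitive t s =
    expR 1 * C * D * (expR ((r - s) / C) - 1).
  have -> : (r - s) / C = (r - t) / C - (s - t) / C by rewrite -mulrBl opprB addrA subrK.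
  rewrite /growth_primitive /D expRD expRN; field; rewrite gt_eqF ?expR_gt0//.
have e2 : (r - s) / C <= expR ((r - s) / C) - 1 by have := expR_ge1Dx ((r - s) / C); lra.
apply: le_trans (_ : D * (expR 1 * (r - s)) <= _).
  by apply: ler_pM => //; [exact: ltW|rewrite subr_ge0 -(@expR0 R) ler_expR|exact: rho_growth].
have -> : D * (expR 1 * (r - s)) = expR 1 * C * D * ((r - s) / C) by field; rewrite gt_eqF.
by rewrite ler_pM2l// !mulr_gt0 ?expR_gt0.
Qed.

(** The local estimate is chained over unit steps, the increments of the primitive adding up. *)
Lemma mdist_growth s r t : 0 <= s -> s <= r -> r <= t -> t <= L ->
  mdist (g s) (g r) <= growth_primitive t r - growth_primitive t s.
Proof.
move=> s0 sr rt tL.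
suff H n : forall s, 0 <= s -> s <= r -> r - s <= n%:R ->
    mdist (g s) (g r) <= growth_primitive t r - growth_primitive t s.
  by apply: (H (Num.truncn (r - s)).+1) => //; rewrite ltW// truncnS_gt.
elim: n => [|n IH] {s0 sr}s s0 sr.
  by move=> rs; apply: mdist_growth_local => //; lra.
rewrite -natr1 => rsn; case: (leP (r - s) 1) => rs1.
  exact: mdist_growth_local.
have h1 : mdist (g s) (g (s + 1)) <= growth_primitive t (s + 1) - growth_primitive t s.
  by apply: mdist_growth_local => //; lra.
have h2 : mdist (g (s + 1)) (g r) <= growth_primitive t r - growth_primitive t (s + 1).
  by apply: IH; lra.
have := metric_triangle (g s) (g (s + 1)) (g r); lra.
Qed.

Lemma curve_length_growth t : 0 <= t <= L ->
  (curve_length g 0 t <= (expR 1 * C * expR A * rho (g t))%:E)%E.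
Proof.
move=> /andP[t0 tL].
apply: le_trans (curve_length_le_increment (F := growth_primitive t) _) _.
  by move=> s r s0 sr rt; exact: mdist_growth.
(* At [t] the primitive equals the claimed bound; its value at [0] is nonnegative and is dropped. *)
rewrite lee_fin {1}/growth_primitive subrr mul0r expR0 mulr1 lerBlDr lerDl.
by rewrite /growth_primitive !mulr_ge0 ?expR_ge0 ?(ltW (rho0 _)) ?(ltW C0).
Qed.

Lemma growth_continuous : {within `[0, L], continuous g}.
Proof.
apply/subspace_continuousP => s /=; rewrite in_itv/= => /andP[s0 sL].
apply/metricType_numDomainType.cvgrPdist_lt => e e0.
have cF : {for s, continuous (growth_primitive L)}.
  apply: cvgM; first exact: cvg_cst.
  apply: continuous_comp; last exact: continuous_expR.
  by apply: cvgM; [apply: cvgB; [exact: cvg_id|exact: cvg_cst]|exact: cvg_cst].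
move/cvgrPdist_lt: cF => /(_ e e0).
rewrite near_withinE => /nbhs_ballP[d /= d0 near].
apply/nbhs_ballP; exists d => //= r sr; rewrite in_itv/= => /andP[r0 rL].
apply: le_lt_trans (near r sr); case: (leP s r) => [|/ltW] h.
  rewrite distrC; apply: le_trans (ler_norm _); exact: mdist_growth.
by rewrite metric_sym; apply: le_trans (ler_norm _); exact: mdist_growth.
Qed.

End GrowingGeodesic.

Theorem theorem1p4 (R : realType) (a delta : R) (ha : 1 <= a)
    (hdelta : 0 <= delta) :
  exists M : R, 1 <= M /\
  forall (X Xbar : metricType R) (iota : X -> Xbar),
    locally_compact [set: X] ->
    ~ complete_space X ->
    rectifiably_connected X ->
    is_completion iota ->
  forall x0 : X,
    is_John iota a x0 ->
  forall hk : is_metric (qh_dist iota),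
    complete_space (metric_space_of hk) ->
    proper_space (metric_space_of hk) ->
    geodesic_space (metric_space_of hk) ->
    gromov_hyperbolic (metric_space_of hk) delta ->
  forall (x : X) (alpha : R -> X),
    @is_geodesic R (metric_space_of hk) x x0 alpha ->
    is_cone_arc iota M x x0 (qh_dist iota x x0) alpha.
Proof.
set C : R := 1 + 2 * a; have C1 : 1 <= C by rewrite /C; lra.
(* [C] and [ln C] are the Lipschitz constant and the additive error supplied by
   [cone_arc_quasi_geodesic]. *)
have [A A0 growth] := geodesic_growth hdelta C1 (ln_ge0 C1).
exists (expR 1 * C * expR A); split.
  have e1 : 1 <= expR 1 :> R by have := expR_ge1Dx (1 : R); lra.
  have eA : 1 <= expR A by have := expR_ge1Dx A; lra.
  by rewrite mulr_ege1// mulr_ege1.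
move=> X Xbar iota lcX ncX _ cpl x0 John hk _ _ geo hyp x alpha ga.
have [L [g cone]] := John x.
have [U [p [U0 p0 pU pL prho]]] := cone_arc_quasi_geodesic lcX ncX cpl hk ha cone.
have sl := gromov_slim geo hyp; have dv := geodesic_space_divisible geo.
have rho0 z := boundary_dist_gt0 lcX ncX cpl z.
have [ga0 gaL gaI] := ga.
have D0 : 0 <= qh_dist iota x x0 := @mdist_ge0 R (metric_space_of hk) x x0.
have gr s t : 0 <= s -> s <= t -> t <= qh_dist iota x x0 ->
    ln (boundary_dist iota (alpha s)) <=
    ln (boundary_dist iota (alpha t)) + A - (t - s) / C.
  have := growth (metric_space_of hk) (fun z => ln (boundary_dist iota z)) p U
    (ln (boundary_dist iota x)) alpha sl dv.
  rewrite p0 pU; apply => //.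
  by move=> u v; exact: (ln_boundary_dist_lip lcX ncX cpl hk u v).
have gd s t : 0 <= s -> s <= t -> t <= qh_dist iota x x0 ->
    mdist (alpha s) (alpha t) <= boundary_dist iota (alpha s) * (expR (t - s) - 1).
  move=> s0 st tD; rewrite -(geodesic_mdist ga s0 st tD).
  exact: (mdist_le_qh_dist lcX ncX cpl hk).
split; last exact: (curve_length_growth C1 rho0 gd gr).
split.
  by split=> //; exact: (growth_continuous C1 rho0 gd gr).
(* [alpha] is isometric for the quasihyperbolic metric, hence injective. *)
move=> s t; rewrite !in_itv/= => sI tI st; apply/eqP; rewrite -subr_eq0 -normr_eq0.
by rewrite -(gaI s t sI tI) st mdistxx.
Qed.
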